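(* Let $d$ be a proper distance on $\mathbb{R}^n$ that is translation invariant and induces the standard topology of $\mathbb{R}^n$. Assume that $(\mathbb{R}^n,d)$ is linearly connected. Then $(\mathbb{R}^n,d)$ has Nagata dimension equal to $n$.
   Context: A distance $d$ on $\mathbb{R}^n$ is translation invariant if $d(x,y)=d(x+v,y+v)$ for all $x,y,v\in\mathbb{R}^n$. A distance is proper if all its closed balls are compact. A metric space $X$ is linearly connected if there is $\lambda\ge 1$ such that for all $x,y\in X$ there is a connected subset $S\subset X$ containing $x$ and $y$ with $\operatorname{diam}(S)\le \lambda d(x,y)$. Nagata dimension: for a cover $\mathcal{B}$ of a metric space $X$ and $s>0$, the $s$-multiplicity of $\mathcal{B}$ is the infimum of all $m$ such that every subset of $X$ of diameter $\le s$ meets at most $m$ members of $\mathcal{B}$. The cover $\mathcal{B}$ is $D$-bounded if $\operatorname{diam} B\le D$ for all $B\in\mathcal{B}$. The Nagata dimension $\dim_N X$ is the infimum of all integers $m\geq 0$ for which there exists a constant $c>0$ such that, for all $s>0$, $X$ admits a $cs$-bounded cover with $s$-multiplicity at most $m+1$. *)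

(* Defs.v *)
From HB Require Import structures.
From mathcomp Require Import all_boot all_order all_algebra.
From mathcomp Require Import all_classical all_reals all_analysis.

Set Implicit Arguments.
Unset Strict Implicit.
Unset Printing Implicit Defensive.

Import Order.TTheory GRing.Theory Num.Theory.
Import numFieldNormedType.Exports.

Local Open Scope classical_set_scope.
Local Open Scope ring_scope.

Record distance (R : realType) (T : Type) := Distance {
  dist :> T -> T -> R ;
  dist_xx : forall x, dist x x = 0 ;
  dist_eq0 : forall x y, dist x y = 0 -> x = y ;
  dist_sym : forall x y, dist x y = dist y x ;
  dist_triangle : forall y x z, dist x z <= dist x y + dist y z
}.

(* A copy of T whose topology is the metric topology of d. A topology that T
   may already have, such as the standard one on 'rV[R]_n, is not inherited. *)
Definition metric_space (R : realType) (T : choiceType) (d : distance R T) :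
  Type := T.

HB.instance Definition _ (R : realType) (T : choiceType) (d : distance R T) :=
  Choice.copy (metric_space d) T.

HB.instance Definition _ (R : realType) (T : choiceType) (d : distance R T) :=
  isMetric.Build R (metric_space d) (dist_xx d) (@dist_eq0 _ _ d)
    (dist_sym d) (dist_triangle d).

Lemma metric_spaceE (R : realType) (T : choiceType) (d : distance R T) :
  @mdist R (metric_space d) = d.
Proof. by []. Qed.

Section metric_notions.
Context {R : realType}.

(* diam set0 = -oo; below, diameters are only compared with nonnegative
   bounds, so that this agrees with the convention diam set0 = 0. *)
Definition diam (X : metricType R) (A : set X) : \bar R :=
  ereal_sup [set (mdist p.1 p.2)%:E | p in A `*` A].

(* The library's closed_ball is the closure of the open ball, which may be
   smaller than the closed ball of a metric space. *)
Definition proper_metric (X : metricType R) : Prop :=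
  forall (x : X) (r : R), compact [set y : X | mdist x y <= r].

Definition linearly_connected (X : metricType R) : Prop :=
  exists2 lambda : R, 1 <= lambda &
    forall x y : X, exists S : set X,
      [/\ connected S, S x, S y & (diam S <= (lambda * mdist x y)%:E)%E].

Definition is_cover (X : metricType R) (B : set (set X)) : Prop :=
  \bigcup_(b in B) b = setT.

Definition bounded_cover (X : metricType R) (D : R) (B : set (set X)) : Prop :=
  forall b, B b -> (diam b <= D%:E)%E.

(* +oo if no natural number bounds the number of members met *)
Definition multiplicity (X : metricType R) (s : R) (B : set (set X)) : \bar R :=
  ereal_inf [set m%:R%:E | m in [set m : nat |
    forall A : set X, (diam A <= s%:E)%E ->
      ([set b | B b /\ b `&` A !=set0] #<= `I_m)%card]].

(* +oo if no natural number is admissible *)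
Definition nagata_dim (X : metricType R) : \bar R :=
  ereal_inf [set m%:R%:E | m in [set m : nat |
    exists2 c : R, 0 < c &
      forall s : R, 0 < s -> exists B : set (set X),
        [/\ is_cover B, bounded_cover (c * s) B &
            (multiplicity s B <= m.+1%:R%:E)%E]]].

End metric_notions.

Definition translation_invariant (R : realType) (V : zmodType)
    (d : distance R V) : Prop :=
  forall x y v, d x y = d (x + v) (y + v).

Definition induces_topology (R : realType) (T : topologicalType)
    (d : distance R T) : Prop :=
  forall A : set T, @open (metric_space d) A <-> @open T A.

(* Main.v *)
Require Import Defs.
From mathcomp Require Import all_boot all_order all_algebra.
From mathcomp Require Import all_classical all_reals all_analysis.
From mathcomp Require Import perm zify ring lra.
Import Order.TTheory GRing.Theory Num.Theory.
Import numFieldNormedType.Exports.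
Local Open Scope ring_scope.

(** Write N x for d 0 x. Invariance makes N even and subadditive, and the
    distance from x to y is N (y - x).

    Both inequalities rest on one combinatorial fact, the cubical Sperner lemma
    [rainbow_cube_exists]: if the vertices of a grid carry labels 0, ..., n so
    that label i never occurs on the far face of coordinate i and labels above
    i never occur on its near face, then some unit cube of the grid carries all
    n + 1 labels.

    Lower bound ([small_cover_multiplicity]). Members of a cover with small
    diameter cannot meet two opposite faces of the unit cube. On a fine grid of
    that cube, choose a member containing each vertex, and label the vertex by
    the first near face that this member meets. A unit cube of the grid with
    all labels then meets n + 1 members, and its diameter is as small as wanted.

    Upper bound ([coloured_box_cover]). It suffices to find, at every scale s, a
    linear change of coordinates in which the ball of radius s lies in the cube
    of radius 2 and the cube of radius 1 lies in the ball of radius C s, with C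
    independent of s ([ball_parallelepiped]): the usual covers of R^n by boxes
    in n + 1 colours can then be pulled back. Balls may grow exponentially with
    their radius, so the two balls cannot be compared by volume. Instead,
    let U be the connected component of 0 in the ball of radius lambda s. Linear
    connectedness says that U contains the ball of radius s. Take as coordinates
    a basis x_1, ..., x_n of points of U whose determinant is at least half of
    the supremum; by Cramer's rule, U lies in the cube of radius 2.

    It remains to bound N on the unit cube. A connected set joins 0 to x_i inside
    U; repeat it periodically in the direction x_i. The sum of these n curves
    defines a map on R^n at bounded distance from the identity, hence onto by
    the Poincare-Miranda theorem. So every point is, up to an error as small as
    wanted, a lattice point plus n points of U: it is at N-distance at most
    (n + 1) lambda s from a lattice point which is also close to it in
    coordinates ([lattice_approx]). For a point q of the unit cube, walk along the segment from 0 to q. If N q were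
    large, the segment would contain many points whose values of N are far
    apart; their lattice points would be distinct, yet only a number of them
    depending on n fits in the region at hand ([unit_cube_bounded]). *)

Set Implicit Arguments.
Unset Strict Implicit.
Unset Printing Implicit Defensive.

(** * The cubical Sperner lemma *)

Section Sperner.
Import mathcomp.boot.fintype mathcomp.boot.finset.
Context {n m : nat}.
Local Notation vertex := {ffun 'I_n -> 'I_m.+2}.

(** Vertices live on a torus, so that translations are bijections of the index
    set of all sums below; no wrap-around occurs in the cubes that matter. *)
Definition corner (A : {set 'I_n}) : vertex := [ffun i => (i \in A)%:R].

Lemma cornerD1 (A : {set 'I_n}) i : i \in A ->
  corner [set i] + corner (A :\ i) = corner A.
Proof.
move=> iA; apply/ffunP => j; rewrite !ffunE !inE.
by case: eqVneq => [->|_] /=; rewrite ?iA ?addr0 ?add0r.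
Qed.

Context (lab : vertex -> 'I_n.+1).

(** With k the size of A: number modulo 2 of chains of vertices from x to
    x + corner A, raising one coordinate of A at a time, whose labels are the
    elements of L, each once. These chains are the simplices of Kuhn's
    triangulation of the cube; recursion on the last vertex replaces the
    bookkeeping with permutations. *)
Fixpoint rainbow (k : nat) (L : {set 'I_n.+1}) (x : vertex)
    (A : {set 'I_n}) : 'F_2 :=
  let y := lab (x + corner A) in
  if k is k'.+1
  then (y \in L)%:R * \sum_(i in A) rainbow k' (L :\ y) x (A :\ i)
  else (L == [set y])%:R.

Lemma rainbow_absent {k} (L : {set 'I_n.+1}) x (A : {set 'I_n}) l :
  l \in L -> (forall B : {set 'I_n}, B \subset A -> lab (x + corner B) != l) ->
  rainbow k L x A = 0.
Proof.
elim: k L A => [|k IH] L A lL labA /=.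
  case: eqVneq => // eL; have := labA A (subxx _).
  by move: lL; rewrite eL inE eq_sym => ->.
rewrite big1 ?mulr0 // => i iA; apply: IH => [|B BA].
  by rewrite !inE lL andbT eq_sym labA.
by apply: labA; apply: (subset_trans BA); rewrite subsetDl.
Qed.

Lemma rainbow_last {k} (L : {set 'I_n.+1}) x (A : {set 'I_n}) :
  lab (x + corner A) \notin L -> rainbow k L x A = 0.
Proof.
case: k => [|k] /=; last by move=> /negPf ->; rewrite mul0r.
by case: eqVneq => // ->; rewrite inE eqxx.
Qed.

Lemma addrr_F2 (a : 'F_2) : a + a = 0.
Proof. by apply: addrr_pchar2; rewrite pchar_Fp. Qed.

(** The terms of indices (i, j) and (j, i) cancel. *)
Lemma sum_offdiag_F2 (A : {set 'I_n}) (F : 'I_n -> 'I_n -> 'F_2) :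
  (forall i j, F i j = F j i) ->
  \sum_(i in A) \sum_(j in A :\ i) F i j = 0.
Proof.
move=> FC; rewrite pair_big_dep /=.
rewrite (bigID (fun p : 'I_n * 'I_n => p.1 < p.2)%N) /=.
rewrite [X in _ + X](reindex_inj
  (h := fun p : 'I_n * 'I_n => (p.2, p.1))) /=; last first.
  by move=> [? ?] [? ?] [-> ->].
rewrite [X in _ + X](eq_big (fun p : 'I_n * 'I_n =>
  [&& p.1 \in A, p.2 \in A :\ p.1 & (p.1 < p.2)%N]) (fun p => F p.1 p.2)).
- rewrite (eq_bigl (fun p : 'I_n * 'I_n =>
    [&& p.1 \in A, p.2 \in A :\ p.1 & (p.1 < p.2)%N])) ?addrr_F2 // => p.
  by rewrite andbA.
- move=> [i j] /=; rewrite !inE -!val_eqE /=.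
  by case: (i \in A); case: (j \in A); rewrite ?andbF ?andbT //=; case: ltngtP.
- by move=> [i j] _; rewrite FC.
Qed.

(** The case where the label of the last vertex is outside L. That label must
    be the extra one q, and only the facets through x can use all of L. *)
Lemma rainbow_coboundary_fresh k (L : {set 'I_n.+1}) x (A : {set 'I_n}) :
  lab (x + corner A) \notin L ->
  \sum_(i in A) (rainbow k L (x + corner [set i]) (A :\ i)
                 + rainbow k L x (A :\ i))
  = \sum_(q | q \notin L) rainbow k.+1 (q |: L) x A.
Proof.
set y := lab (x + corner A) => yL.
rewrite [RHS](bigD1 y) //= [X in _ = _ + X]big1 ?addr0; last first.
  move=> q /andP[qL qy].
  by rewrite -/y !inE (negPf yL) orbF eq_sym (negPf qy) mul0r.
rewrite -/y setU1K // setU11 mul1r; apply: eq_bigr => i iA.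
by rewrite rainbow_last ?add0r // -addrA cornerD1.
Qed.

(** The door argument of Sperner's lemma. The left side counts the simplices
    with label set L on the boundary of the cube; those inside the cube are
    facets of two chains and cancel. Of the facets of a maximal chain, exactly
    one has label set L if the chain carries L and one new label q, and none or
    two otherwise. *)
Lemma rainbow_coboundary k (L : {set 'I_n.+1}) x (A : {set 'I_n}) :
  #|A| = k.+1 ->
  \sum_(i in A) (rainbow k L (x + corner [set i]) (A :\ i)
                 + rainbow k L x (A :\ i))
  = \sum_(q | q \notin L) rainbow k.+1 (q |: L) x A.
Proof.
elim: k L A => [|k IH] L A cA;
  (have [yL|yL] := boolP (lab (x + corner A) \in L);
    last exact: rainbow_coboundary_fresh);
  set y := lab (x + corner A) in yL;
  have yE i : i \in A -> lab (x + corner [set i] + corner (A :\ i)) = y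
    by move=> iA; rewrite -addrA cornerD1.
- have [i eA] : exists i, A = [set i] by apply/cards1P; rewrite cA.
  have c0 : corner set0 = 0 by apply/ffunP => j; rewrite !ffunE inE.
  have yx : lab (x + corner [set i]) = y by rewrite /y eA.
  set z := lab x.
  transitivity (\sum_(q | q \notin L) ((q |: L :\ y) == [set z])%:R : 'F_2);
    last first.
    apply: eq_bigr => q qL.
    rewrite /= -/y eA big_set1 setDv c0 addr0 -/z !inE yL orbT mul1r setDUl.
    congr ((_ :|: _ == _)%:R); apply/esym/setDidPl; rewrite disjoints1 inE.
    by apply: contraNneq qL => ->.
  rewrite eA big_set1 /= setDv c0 !addr0 yx -/z.
  have [L'0|[l lL]] := set_0Vmem (L :\ y).
    have eL : L = [set y] by rewrite -(setD1K yL) L'0 setU0.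
    under eq_bigr do rewrite L'0 setU0 (inj_eq set1_inj).
    rewrite eL eqxx (inj_eq set1_inj).
    have [<-|nyz] := eqVneq y z.
      rewrite addrr_F2 big1 // => q; rewrite inE => /negPf -> //.
    rewrite addr0 (bigD1 z) ?inE 1?eq_sym //= eqxx big1 ?addr0 //.
    by move=> q /andP[_ /negPf ->].
  rewrite big1 => [|q qL]; last first.
    case: eqP => // e; have := setU11 q (L :\ y); rewrite e inE => /eqP eq.
    have : l \in q |: (L :\ y) by rewrite setU1r.
    rewrite e inE -eq => /eqP elq.
    by move: lL qL; rewrite !inE elq => /andP[_ ->].
  have [ly lL'] : l != y /\ l \in L by move: lL; rewrite !inE => /andP[].
  have nL w : (L == [set w]) = false.
    apply/eqP => e; move: lL' yL; rewrite e !inE => /eqP lw /eqP yw.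
    by rewrite lw yw eqxx in ly.
  by rewrite !nL addr0.
- have eL : y |: (L :\ y) = L by rewrite setD1K.
  set L' := L :\ y in eL *.
  have IH' i : i \in A ->
      \sum_(q | q \notin L) rainbow k.+1 (q |: L') x (A :\ i)
      = rainbow k.+1 L x (A :\ i)
        + \sum_(j in A :\ i) (rainbow k L' (x + corner [set j]) (A :\ i :\ j)
                 + rainbow k L' x (A :\ i :\ j)).
    move=> iA; rewrite IH; last first.
      by apply/eqP; rewrite -(eqn_add2l 1) -[X in _ == X]cA (cardsD1 i A) iA.
    rewrite [in RHS](bigD1 y) ?eL ?setD11 //= addrA addrr_F2 add0r.
    apply: eq_bigl => q; rewrite !inE.
    by case: (eqVneq q y) => [->|]; rewrite ?yL ?andbF ?andbT.
  transitivity (\sum_(i in A) \sum_(q | q \notin L)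
      rainbow k.+1 (q |: L') x (A :\ i)); last first.
    rewrite exchange_big /=; apply: eq_bigr => q qL.
    rewrite -/y setU1r // mul1r.
    apply: eq_bigr => i iA; congr (rainbow k.+1 _ _ _).
    rewrite setDUl; congr (_ :|: _).
    by apply/esym/setDidPl; rewrite disjoints1 inE; apply: contraNneq qL => ->.
  rewrite (eq_bigr _ IH') !big_split /= addrC; congr (_ + _).
  have sym : \sum_(i in A) \sum_(j in A :\ i) rainbow k L' x (A :\ i :\ j) = 0.
    apply: (@sum_offdiag_F2 A (fun i j => rainbow k L' x (A :\ i :\ j))) => i j.
    by congr (rainbow k L' x _); rewrite !setDDl setUC.
  under [in RHS]eq_bigr do rewrite big_split.
  rewrite big_split /= sym addr0.
  under eq_bigr => i iA do rewrite yE // yL mul1r.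
  rewrite (exchange_big_dep (fun j => j \in A)) /=; last first.
    by move=> i j _; rewrite !inE => /andP[].
  apply: eq_bigr => j jA; apply: eq_big => [i|i]; rewrite !inE 1?eq_sym.
    by rewrite jA andbT andbC.
  by move=> /andP[_ _]; rewrite -/L' !setDDl setUC.
Qed.


Arguments rainbow : simpl never.

(** x is the base vertex of a unit cube in the face of the grid where the
    coordinates outside A vanish. *)
Definition in_face (A : {set 'I_n}) (x : vertex) :=
  [forall i, if i \in A then x i != ord_max else x i == 0].

Lemma ord_succ_eq0 (a : 'I_m.+2) : (a + 1 == 0) = (a == ord_max).
Proof.
rewrite -!val_eqE /= [(1 %% _)%N]modn_small //.
have := ltn_ord a; rewrite ltnS leq_eqVlt => /orP[/eqP ->|alt].
  by rewrite addn1 modnn !eqxx.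
by rewrite modn_small ?addn1 // (ltn_eqF alt).
Qed.

(** Summing over the cubes in a row, interior facets cancel modulo 2; those on
    the far side vanish by assumption. *)
Lemma sum_face_coboundary (A : {set 'I_n}) i (H : vertex -> 'F_2) : i \in A ->
  (forall x : vertex, x i = ord_max -> H x = 0) ->
  \sum_(x | in_face A x) (H (x + corner [set i]) + H x)
  = \sum_(x | in_face (A :\ i) x) H x.
Proof.
move=> iA Hmax.
pose P (x : vertex) :=
  [forall j, (j != i) ==> if j \in A then x j != ord_max else x j == 0].
have faceA x : in_face A x = P x && (x i != ord_max).
  apply/forallP/andP => [fx|[/forallP Px xi] j].
    split; last by have := fx i; rewrite iA.
    by apply/forallP => j; apply/implyP => _; apply: fx.
  by case: (eqVneq j i) => [->|ji]; [rewrite iA|move: (Px j); rewrite ji].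
have faceA1 x : in_face (A :\ i) x = P x && (x i == 0).
  apply/forallP/andP => [fx|[/forallP Px xi] j].
    split; last by have := fx i; rewrite setD11.
    by apply/forallP => j; apply/implyP => ji; have := fx j; rewrite !inE ji.
  by rewrite !inE; case: (eqVneq j i) => [->|ji] //=; move: (Px j); rewrite ji.
under eq_bigl do rewrite faceA.
under [RHS]eq_bigl do rewrite faceA1.
rewrite big_split /=.
have -> : \sum_(x | P x && (x i != ord_max)) H (x + corner [set i])
    = \sum_(x | P x && (x i != 0)) H x.
  rewrite [RHS](reindex_inj (addIr (corner [set i]))) /=.
  apply: eq_bigl => x; rewrite !ffunE inE eqxx ord_succ_eq0; congr (_ && _).
  apply: eq_forallb => j; rewrite !ffunE inE.
  by case: (eqVneq j i) => // _; rewrite addr0.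
have splitm : \sum_(x | P x) H x = \sum_(x | P x && (x i != ord_max)) H x.
  rewrite (bigID (fun x : vertex => x i == ord_max)) /= big1 ?add0r //.
  by move=> x /andP[_ /eqP]; exact: Hmax.
rewrite -splitm [X in _ + X](bigID (fun x : vertex => x i == 0)) /=.
by rewrite addrCA addrr_F2 addr0.
Qed.

(** By induction on p, the number of simplices with labels 0, ..., p in the face
    spanned by the first p coordinates is odd: by the coboundary formula it is
    the number of simplices with labels 0, ..., p - 1 on the boundary of this
    face, and the boundary conditions leave only the facet where coordinate
    p - 1 vanishes. *)
Lemma rainbow_cube_exists :
  (forall (x : vertex) i, x i = 0 -> (lab x <= i)%N) ->
  (forall (x : vertex) i, x i = ord_max -> lab x <> i :> nat) ->
  exists x : vertex, (forall i, x i != ord_max)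
    /\ forall l, exists B : {set 'I_n}, lab (x + corner B) = l.
Proof.
move=> lab0 labmax.
pose A p := [set i : 'I_n | (i < p)%N].
pose L p := [set l : 'I_n.+1 | (l <= p)%N].
have total p : (p <= n)%N ->
    \sum_(x | in_face (A p) x) rainbow p (L p) x (A p) = 1.
  elim: p => [_|p IH pn].
    have A0 : A 0%N = set0 by apply/setP => i; rewrite !inE.
    have c0 : corner set0 = 0 by apply/ffunP => j; rewrite !ffunE inE.
    rewrite A0 (big_pred1 (0 : vertex)) => [|x]; last first.
      apply/forallP/eqP => [fx|-> i]; last by rewrite inE ffunE.
      by apply/ffunP => i; have := fx i; rewrite inE ffunE => /eqP.
    rewrite /rainbow c0 addr0 (_ : _ == _) //; apply/eqP/setP => l.
    rewrite !inE -val_eqE /=.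
    suff -> : lab 0 = 0%N :> nat by rewrite leqn0.
    case: (posnP n) => [n0|n0].
      by apply/eqP; rewrite -leqn0 -ltnS -[X in (_ < X.+1)%N]n0.
    by apply/eqP; rewrite -leqn0; apply: (lab0 _ (Ordinal n0)); rewrite ffunE.
  pose i0 := Ordinal pn.
  have cA : #|A p.+1| = p.+1.
    have wI : injective (widen_ord pn).
      by move=> a b /(congr1 val) ?; apply: val_inj.
    rewrite -[RHS](card_ord p.+1) -(card_imset _ wI).
    apply: eq_card => i; rewrite !inE; apply/idP/imsetP => [ip|[j _ ->]].
      by exists (Ordinal ip) => //; apply/val_inj.
    by rewrite /= ltn_ord.
  have AD : A p.+1 :\ i0 = A p.
    by apply/setP => i; rewrite !inE -val_eqE /= ltnS ltn_neqAle.
  have LD : L p.+1 = inord p.+1 |: L p.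
    by apply/setP => l; rewrite !inE -val_eqE /= inordK // leq_eqVlt ltnS.
  transitivity (\sum_(x | in_face (A p.+1) x)
      \sum_(q | q \notin L p) rainbow p.+1 (q |: L p) x (A p.+1)).
    apply: eq_bigr => x fx; rewrite (bigD1 (inord p.+1)) /=; last first.
      by rewrite inE inordK // ltnn.
    rewrite -LD [X in _ + X]big1 ?addr0 // => q /andP[]; rewrite inE -ltnNge => qp.
    rewrite -val_eqE /= inordK // => qp1.
    have pq : (p.+1 < q)%N by rewrite ltn_neqAle eq_sym qp1.
    apply: (rainbow_absent (l := q)); first by rewrite !inE eqxx.
    move=> B BA; have pn' : (p.+1 < n)%N by apply: leq_trans pq _; rewrite -ltnS.
    have : (lab (x + corner B)%R <= p.+1)%N.
      apply: (lab0 _ (Ordinal pn')); rewrite !ffunE.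
      have iA : Ordinal pn' \notin A p.+1 by rewrite inE ltnn.
      have /negPf -> : Ordinal pn' \notin B.
        by apply: contra iA; exact: (subsetP BA).
      by have /forallP/(_ (Ordinal pn')) := fx; rewrite (negPf iA) addr0 => /eqP.
    by apply: contraTneq => ->; rewrite -ltnNge.
  under eq_bigr do rewrite -rainbow_coboundary //.
  rewrite exchange_big /= (bigD1 i0) /=; last by rewrite inE /=.
  have stay (x : vertex) (B C : {set 'I_n}) i :
      B \subset C :\ i -> (x + corner B) i = x i.
    move=> BC; rewrite !ffunE (_ : i \in B = false) ?addr0 //.
    by apply/negP => /(subsetP BC); rewrite setD11.
  have pmax (i : 'I_n) (x : vertex) : (i < p.+1)%N -> x i = ord_max ->
      rainbow p (L p) x (A p.+1 :\ i) = 0.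
    have iK : inord i = i :> nat := inordK (ltnW (ltn_ord i)).
    move=> ip xi; apply: (rainbow_absent (l := inord i)); first by rewrite inE iK.
    move=> B BA; apply/eqP => /(congr1 val) /=.
    rewrite iK; apply: labmax.
    by rewrite (stay _ _ _ _ BA).
  rewrite sum_face_coboundary ?inE //=; last by move=> x; exact: pmax.
  rewrite AD IH ?(ltnW pn) // big1 ?addr0 // => i /andP[]; rewrite inE => ip ii0.
  rewrite sum_face_coboundary ?inE //; last by move=> x; exact: pmax.
  have pK : inord p = p :> nat := @inordK n p (ltnW pn).
  apply: big1 => x fx; apply: (rainbow_absent (l := inord p)).
    by rewrite inE pK.
  move=> B BA; apply/eqP => /(congr1 val) /=; rewrite pK => lp.
  have : (lab (x + corner B)%R <= i)%N.
    apply: lab0; rewrite (stay _ _ _ _ BA).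
    by have /forallP/(_ i) := fx; rewrite setD11 => /eqP.
  rewrite lp leqNgt => /negP; apply; move: ip.
  rewrite ltnS leq_eqVlt -val_eqE /= in ii0 *.
  by rewrite (negPf ii0).
have /eqP := total n (leqnn n).
have [x /andP[fx] rx _|none] := pickP (fun x =>
  in_face (A n) x && (rainbow n (L n) x (A n) != 0)).
  exists x; split=> [i|l]; first by have /forallP/(_ i) := fx; rewrite inE ltn_ord.
  have [|noB] := pselect (exists B : {set 'I_n}, lab (x + corner B) = l) => //.
  case/negP: rx; apply/eqP; apply: (rainbow_absent (l := l)); first by rewrite inE -ltnS.
  by move=> B _; apply/eqP => lB; apply: noB; exists B.
rewrite big1 => [|x fx]; first by rewrite eq_sym oner_eq0.
by apply/eqP; move: (none x); rewrite fx /= => /negbFE.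
Qed.

End Sperner.

(** * Poincare-Miranda on a grid *)

(** The value n means that no index satisfies P. *)
Definition first_index (n : nat) (P : pred 'I_n) : 'I_n.+1 :=
  inord (find P (enum 'I_n)).

Lemma first_indexE n (P : pred 'I_n) :
  first_index P = find P (enum 'I_n) :> nat.
Proof. by rewrite inordK // ltnS -[X in (_ <= X)%N](size_enum_ord n) find_size. Qed.

Lemma first_index_le n (P : pred 'I_n) (i : 'I_n) :
  P i -> (first_index P <= i)%N.
Proof.
move=> Pi; rewrite first_indexE leqNgt; apply/negP => /(before_find i).
by rewrite nth_ord_enum Pi.
Qed.

Lemma first_index_sat n (P : pred 'I_n) (i : 'I_n) :
  first_index P = i :> nat -> P i.
Proof.
rewrite first_indexE => e; have : has P (enum 'I_n).
  by rewrite has_find e size_enum_ord.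
by move/(nth_find i); rewrite e nth_ord_enum.
Qed.

Lemma first_index_none n (P : pred 'I_n) (i : 'I_n) :
  first_index P = n :> nat -> ~~ P i.
Proof.
move=> e; apply/negP => /first_index_le; rewrite e leqNgt.
by rewrite ltn_ord.
Qed.

Lemma sperner_cube n m (P : {ffun 'I_n -> 'I_m.+2} -> pred 'I_n) :
  (forall (x : {ffun _}) i, x i = 0 -> P x i) ->
  (forall (x : {ffun _}) i, x i = ord_max -> ~~ P x i) ->
  exists x : {ffun 'I_n -> 'I_m.+2}, (forall i, x i != ord_max)
    /\ forall l, exists B, first_index (P (x + corner B)) = l.
Proof.
move=> P0 Pmax.
apply: (@rainbow_cube_exists n m (fun x => first_index (P x))) => x i xi.
  exact/first_index_le/P0.
by move=> /first_index_sat; apply/negP/Pmax.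
Qed.

(** Label a vertex by its first negative component. In a cube with all labels,
    the vertex labelled n has no negative component, and the vertex labelled i
    has component i negative. *)
Lemma poincare_miranda_grid (R : realDomainType) n m
    (f : {ffun 'I_n -> 'I_m.+2} -> 'I_n -> R) :
  (forall (x : {ffun _}) i, x i = 0 -> f x i < 0) ->
  (forall (x : {ffun _}) i, x i = ord_max -> 0 <= f x i) ->
  exists x : {ffun 'I_n -> 'I_m.+2}, (forall i, x i != ord_max) /\ exists B,
    forall i, 0 <= f (x + corner B) i /\ exists B', f (x + corner B') i < 0.
Proof.
move=> f0 fmax; have [||x [xmax xP]] := @sperner_cube n m (fun x i => f x i < 0).
- by move=> x i; exact: f0.
- by move=> x i; rewrite -leNgt; exact: fmax.
exists x; split=> //; have [B BP] := xP ord_max; exists B => i; split.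
  rewrite leNgt; apply: (first_index_none (P := fun i => f _ i < 0)).
  exact: (congr1 val BP).
have [B' B'P] := xP (inord i); exists B'.
apply: (first_index_sat (P := fun i => f _ i < 0)).
exact: etrans (congr1 val B'P) (inordK (ltnW (ltn_ord i))).
Qed.

(** * Lattice approximation *)

Section LatticeLemma.
Context {R : realType} {n : nat}.
Local Notation V := 'rV[R]_n.

(** What remains of d 0 after a linear change of coordinates; N is in general
    not homogeneous. *)
Record group_norm (N : V -> R) : Prop := GroupNorm {
  gnorm0 : N 0 = 0 ;
  gnormN : forall x, N (- x) = N x ;
  gnormD : forall x y, N (x + y) <= N x + N y ;
  gnorm_small : forall e : R, 0 < e -> exists2 r : R, 0 < r &
    forall x : V, (forall i, `|x 0 i| < r) -> N x < e
}.

(** Weak form of path-connectedness which connected sets enjoy: 0 is joined to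
    every point of U by finite chains in U with steps as small as wanted, here
    extended by a constant to all indices. *)
Definition chained (U : V -> Prop) : Prop := forall (r : R) x, 0 < r -> U x ->
  exists K (a : nat -> V), [/\ a 0%N = 0, forall t, (K <= t)%N -> a t = x,
    forall t, U (a t) & forall t i, `|(a t.+1 - a t) 0 i| < r].

Definition int_vec (z : 'I_n -> int) : V := \row_i (z i)%:~R.

Context (N : V -> R) (gN : group_norm N) (rho : R) (U : V -> Prop).
Context (rho_gt0 : 0 < rho).
Context (UN : forall x, U x -> N x <= rho).
Context (Ubd : forall (x : V) i, U x -> `|x 0 i| <= 2).
Context (Ue : forall i, U (delta_mx 0 i)).
Context (Uchain : chained U).

Lemma gnorm_sum (I : finType) (F : I -> V) : N (\sum_i F i) <= \sum_i N (F i).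
Proof.
elim/big_ind2: _ => //; first by rewrite gnorm0.
by move=> x a y b xa yb; apply: le_trans (gnormD gN _ _) _; exact: lerD.
Qed.

(** The chain from 0 to the i-th basis vector, repeated with a period K' that
    can be chosen common to all i. *)
Lemma periodic_chain r i : 0 < r -> exists K : nat, (0 < K)%N /\ forall K',
  (K <= K')%N -> exists a : nat -> V,
    [/\ forall t, U (a t),
        forall t j, `|((t.+1 %/ K')%:R *: delta_mx 0 i + a (t.+1 %% K')%N
           - ((t %/ K')%:R *: delta_mx 0 i + a (t %% K')%N)) 0 j| < r
      & a 0%N = 0].
Proof.
move=> r0; have [K [a [a0 aK Ua ast]]] := Uchain r0 (Ue i).
exists K.+1; split=> // K' KK'; exists a; split=> // t j.
have K'0 : (0 < K')%N by lia.
rewrite divnS // modnS; have [dvd|_] := boolP (K' %| t.+1)%N; last first.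
  by rewrite opprD addrACA subrr add0r.
have -> : (t %% K' = K'.-1)%N.
  have lt := ltn_pmod t K'0; move: dvd; rewrite {1}(divn_eq t K') -addnS.
  by rewrite dvdn_addr ?dvdn_mull // => /dvdn_leq; lia.
rewrite a0 addr0 natrD scalerDl scale1r opprD addrA addrK.
by have := ast K'.-1 j; rewrite prednK // (aK K') // ltnW.
Qed.



(** Surjectivity of the sum of the n periodic chains, up to a small error. *)
Lemma lattice_approx (p : V) : exists z : 'I_n -> int,
  N (p - int_vec z) <= n.+1%:R * rho
  /\ forall i, `|(p - int_vec z) 0 i| <= n.*2.+1%:R.
Proof.
have [r1 r1_gt0 Nsmall] := gnorm_small gN rho_gt0.
pose r := Num.min r1 1 / n.+1%:R.
have min_gt0 : 0 < Num.min r1 1 by rewrite lt_min r1_gt0 ltr01.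
have r_gt0 : 0 < r by rewrite divr_gt0 // ltr0n.
have [Ks KsP] := choice (fun i => periodic_chain i r_gt0).
pose K := (\max_i Ks i).+1.
have /choice[a aP] : forall i, exists a : nat -> V,
    [/\ forall t, U (a t),
        forall t j, `|((t.+1 %/ K)%:R *: delta_mx 0 i + a (t.+1 %% K)%N
           - ((t %/ K)%:R *: delta_mx 0 i + a (t %% K)%N)) 0 j| < r
      & a 0%N = 0].
  by move=> i; apply: (KsP i).2; rewrite leqW // (leq_bigmax_cond (F := Ks)).
pose g i t : V := (t %/ K)%:R *: delta_mx 0 i + a i (t %% K)%N.
have gE i t j : g i t 0 j = (t %/ K)%:R * (j == i)%:R + a i (t %% K)%N 0 j.
  by rewrite !mxE eqxx.
have g0 i : g i 0%N = 0 by rewrite /g div0n mod0n scale0r add0r; case: (aP i).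
have g_other i t j : j != i -> `|g i t 0 j| <= 2.
  move=> /negPf ji; rewrite gE ji mulr0 add0r; apply: Ubd; by case: (aP i).
(* Translate p so that its coordinates exceed 2 n, the most that the components
   in U can add up to: this gives the sign on the near faces. *)
pose q : V := \row_i (p 0 i - (Num.floor (p 0 i))%:~R + n.*2.+1%:R).
have qlb i : n.*2.+1%:R <= q 0 i.
  by rewrite mxE lerDr subr_ge0 ge_floor.
have qub i : q 0 i <= n.*2.+2%:R.
  rewrite mxE -[n.*2.+2]addn1 natrD addrC lerD2l lerBlDr addrC.
  by rewrite ltW // -[1]/(1%:~R) -intrD floorD1_gt.
(* H periods suffice for the sign on the far faces: H - 2 n >= 2 n + 2 >= q i. *)
pose H := (4 * n + 3)%N.
pose m := (H * K).-1.
have mE : (m.+1 = H * K)%N by rewrite /m /H /K; nia.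
pose f (x : {ffun 'I_n -> 'I_m.+2}) i := (\sum_j g j (x j)) 0 i - q 0 i.
have f0 (x : {ffun 'I_n -> 'I_m.+2}) i : x i = 0 -> f x i < 0.
  move=> xi; rewrite /f subr_lt0 summxE.
  apply: lt_le_trans (qlb i).
  apply: (@le_lt_trans _ _ n.*2%:R); last by rewrite ltr_nat.
  have -> : n.*2%:R = \sum_(j < n) 2 :> R.
    by rewrite sumr_const card_ord -mul2n natrM mulr_natr.
  apply: ler_sum => j _; have [->|ji] := eqVneq j i.
    by rewrite xi g0 mxE.
  by apply: le_trans (ler_norm _) (g_other _ _ _ _); rewrite eq_sym.
have fmax (x : {ffun 'I_n -> 'I_m.+2}) i : x i = ord_max -> 0 <= f x i.
  move=> xi; rewrite /f subr_ge0 summxE; apply: le_trans (qub i) _.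
  have -> : \sum_j g j (x j) 0 i = H%:R + \sum_(j < n | j != i) g j (x j) 0 i.
    rewrite (bigD1 i) //= gE (_ : nat_of_ord (x i) = (H * K)%N) ?xi //.
    by have [_ _ ai0] := aP i; rewrite mulnK // modnMl eqxx mulr1 ai0 mxE addr0.
  have : - (n.*2%:R) <= \sum_(j < n | j != i) g j (x j) 0 i.
    have -> : - n.*2%:R = \sum_(j < n) (- 2) :> R.
      by rewrite sumr_const card_ord -mul2n natrM mulNrn mulr_natr.
    rewrite [X in X <= _](bigD1 i) //= -[X in _ <= X]add0r; apply: lerD => //.
    apply: ler_sum => j ji; rewrite lerNl.
    by apply: le_trans (ler_norm _) _; rewrite normrN g_other // eq_sym.
  rewrite -(lerD2l H%:R); apply: le_trans.
  by rewrite -natrB ?ler_nat /H; lia.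
have [x [xmax [B BP]]] := poincare_miranda_grid f0 fmax.
have near_f i B' : f (x + corner B) i - f (x + corner B') i < Num.min r1 1.
  rewrite /f opprB addrA subrK !summxE -sumrB.
  apply: le_lt_trans (_ : n%:R * r < _); last first.
    by rewrite mulrA ltr_pdivrMr ?ltr0n // mulrC ltr_pM2l // ltr_nat.
  have -> : n%:R * r = \sum_(j < n) r by rewrite sumr_const card_ord mulr_natl.
  apply: ler_sum => j _; apply: le_trans (ler_norm _) _.
  have corner_val C : (x + corner C) j = (x j + (j \in C))%N :> nat.
    rewrite !ffunE; have := xmax j; rewrite -val_eqE /= => xj.
    have xlt := ltn_ord (x j).
    by case: (j \in C); rewrite /= ?modn_small //=; lia.
  have st := aP j; case: st => _ st _.
  rewrite !corner_val; case: (j \in B); case: (j \in B'); rewrite ?addn0 ?addn1.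
  - by rewrite subrr normr0 ltW.
  - by have := st (x j) i; rewrite -/(g j _) -/(g j _) !mxE => /ltW.
  - by have := st (x j) i; rewrite -/(g j _) -/(g j _) distrC !mxE => /ltW.
  - by rewrite subrr normr0 ltW.
pose w j : nat := (x + corner B) j.
pose sm : V := \sum_j g j (w j) - q.
have smE i : sm 0 i = f (x + corner B) i by rewrite /sm mxE [(- q) _ _]mxE.
have sm_bd i : 0 <= sm 0 i < Num.min r1 1.
  have [fB [B' fB']] := BP i; rewrite smE fB /=.
  by apply: lt_trans (near_f i B'); rewrite ltrBrDl gtrDr.
pose s j := a j (w j %% K)%N.
exists (fun i => Num.floor (p 0 i) - n.*2.+1%:Z + (w i %/ K)%:Z).
set z := int_vec _.
have -> : p - z = \sum_j s j - sm.
  apply/rowP => i; rewrite /sm !mxE !summxE /s.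
  under [X in _ = _ - (X - _)]eq_bigr do rewrite gE.
  rewrite big_split /= [\sum_j (w j %/ K)%:R * _](bigD1 i) //= eqxx mulr1.
  rewrite [\sum_(j | j != i) (w j %/ K)%:R * _]big1; last first.
    by move=> j /negPf ji; rewrite eq_sym ji mulr0.
  by rewrite !intrD mulrNz -!pmulrn; ring.
split=> [|i].
  apply: le_trans (gnormD gN _ _) _; rewrite gnormN // -natr1 mulrDl mul1r.
  apply: lerD; last first.
    apply/ltW/Nsmall => i; have /andP[s0 s1] := sm_bd i.
    by rewrite ger0_norm //; apply: lt_le_trans s1 _; rewrite ge_min lexx.
  apply: le_trans (gnorm_sum _) _; rewrite mulr_natl -[in X in _ <= X](card_ord n).
  rewrite -sumr_const; apply: ler_sum => j _; apply: UN.
  by have [+ _ _] := aP j; apply.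
rewrite mxE [X in `|_ + X|]mxE -natr1; apply: le_trans (ler_normB _ _) _.
apply: lerD; last first.
  have /andP[s0 s1] := sm_bd i.
  by rewrite ger0_norm //; apply/ltW/(lt_le_trans s1); rewrite ge_min lexx orbT.
rewrite summxE; apply: le_trans (ler_norm_sum _ _ _) _.
rewrite -mul2n natrM mulr_natr -[in X in _ <= X](card_ord n) -sumr_const.
by apply: ler_sum => j _; apply: Ubd; have [+ _ _] := aP j; apply.
Qed.

Lemma gnorm_ge_sub x y : N x - N y <= N (x - y).
Proof. by rewrite lerBlDr -{1}(subrK y x); exact: gnormD. Qed.

Lemma int_vec_bound (p : V) z :
  (forall i, `|p 0 i| <= 1) ->
  (forall i, `|(p - int_vec z) 0 i| <= n.*2.+1%:R) ->
  forall i, (`|z i| <= n.*2.+2%:Z)%R.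
Proof.
move=> p1 pz i; rewrite -(ler_int R) -[n.*2.+2]addn1 intr_norm.
have -> : (z i)%:~R = p 0 i - (p - int_vec z) 0 i :> R.
  by rewrite !mxE opprB addrC subrK.
apply: le_trans (ler_normB _ _) _; rewrite addrC PoszD intrD.
exact: lerD.
Qed.

(** If N q exceeded H D, the segment from 0 to q would contain H + 1 points with
    values of N close to 0, D, ..., H D. Lattice points approximating them are
    pairwise distinct, but H is the number of lattice points with coordinates
    at most 2 n + 2 in absolute value. *)
Lemma unit_cube_bounded (q : V) : (forall i, `|q 0 i| <= 1) ->
  N q <= ((((4 * n + 4).+1) ^ n) * (2 * n + 3))%:R * rho.
Proof.
move=> q1; set H := (((4 * n + 4).+1) ^ n)%N; set D := (2 * n + 3)%:R * rho.
rewrite natrM -mulrA -/D leNgt; apply/negP => HDq.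
have D_ge0 : 0 <= D by rewrite mulr_ge0 // ltW.
have [r1 r1_gt0 Nsmall] := gnorm_small gN rho_gt0.
pose L := (Num.truncn r1^-1).+1.
have Lr : L%:R^-1 < r1.
  by rewrite invf_plt ?posrE ?ltr0n // truncnS_gt.
have L_gt0 : 0 < L%:R :> R by rewrite ltr0n.
pose pt (t : nat) : V := (t%:R / L%:R) *: q.
have pt_step t : N (pt t.+1) < N (pt t) + rho.
  have -> : pt t.+1 = pt t + L%:R^-1 *: q.
    by rewrite /pt -scalerDl -[in LHS]natr1 mulrDl mul1r.
  apply: le_lt_trans (gnormD gN _ _) _; rewrite ltrD2l; apply: Nsmall => i.
  rewrite mxE normrM gtr0_norm ?invr_gt0 //; apply: le_lt_trans Lr.
  by rewrite ler_piMr // ltW // invr_gt0.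
have hit (j : 'I_H.+1) : exists t : nat,
    [/\ (t <= L)%N, j%:R * D <= N (pt t) & N (pt t) < j%:R * D + rho].
  pose P t := j%:R * D <= N (pt t).
  have PL : P L.
    rewrite /P /pt divff ?gt_eqF // scale1r; apply: le_trans (ltW HDq).
    by apply: ler_wpM2r => //; rewrite ler_nat -ltnS.
  have [t Pt tmin] := ex_minnP (ex_intro P L PL).
  exists t; split=> //; first exact: tmin.
  case: t Pt tmin => [|t] _ tmin.
    by rewrite /pt mul0r scale0r gnorm0 // ltr_wpDl // mulr_ge0.
  apply: lt_le_trans (pt_step t) _; rewrite lerD2r leNgt; apply/negP => /ltW.
  by move/tmin; rewrite ltnn.
have [T TP] := choice hit.
have [z zP] := choice (fun j => lattice_approx (pt (T j))).
have ptT1 j i : `|pt (T j) 0 i| <= 1.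
  have [TL _ _] := TP j; rewrite mxE normrM ger0_norm ?divr_ge0 //.
  by apply: mulr_ile1 => //; rewrite ?divr_ge0 // ler_pdivrMr // mul1r ler_nat.
have zbd j i := int_vec_bound (ptT1 j) (zP j).2 i.
pose code j : {ffun 'I_n -> 'I_(4 * n + 4).+1} :=
  [ffun i => inord (absz (z j i + n.*2.+2%:Z)%R)].
have code_z j k : code j = code k -> z j =1 z k.
  move=> /ffunP cjk i; have := cjk i; rewrite !ffunE => /(congr1 val) /=.
  have := zbd j i; have := zbd k i; rewrite !ler_norml => /andP[? ?] /andP[? ?].
  rewrite !inordK; lia.
have code_lt (j k : 'I_H.+1) : (j < k)%N -> code j <> code k.
  move=> jk /code_z zjk; have [_ _ Tj] := TP j; have [_ Tk _] := TP k.
  have ezjk : int_vec (z j) = int_vec (z k) by apply/rowP => i; rewrite !mxE zjk.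
  have : N (pt (T k) - pt (T j)) <= n.+1%:R * rho + n.+1%:R * rho.
    have -> : pt (T k) - pt (T j)
        = (pt (T k) - int_vec (z k)) + - (pt (T j) - int_vec (z j)).
      by rewrite ezjk opprB addrA subrK.
    apply: le_trans (gnormD gN _ _) _; rewrite gnormN //.
    by apply: lerD; [exact: (zP k).1|exact: (zP j).1].
  have sub := gnorm_ge_sub (pt (T k)) (pt (T j)).
  have : (j%:R + 1) * D <= k%:R * D.
    by apply: ler_wpM2r => //; rewrite natr1 ler_nat.
  have : D = n.+1%:R * rho + n.+1%:R * rho + rho.
    by rewrite /D natrD natrM -natr1; ring.
  rewrite mulrDl mul1r => De; move: sub Tj Tk; rewrite {}De.
  move: (n.+1%:R * rho) (N _) (N _) (N _) (j%:R * _) (k%:R * _) => ? ? ? ? ? ?.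
  lra.
have : injective code.
  move=> j k cjk; apply/val_inj => /=; have [jk|kj|//] := ltngtP j k.
    by case: (code_lt _ _ jk).
  by case: (code_lt _ _ kj).
move/leq_card; rewrite card_ord card_ffun !card_ord ltnn; done.
Qed.

End LatticeLemma.

(** * Topology of a translation-invariant distance *)

Section InvariantDistance.
Context {R : realType} {n : nat} (d : distance R 'rV[R]_n).
Context (d_invariant : translation_invariant d).
Local Notation V := 'rV[R]_n.

Lemma distE x y : d x y = d 0 (y - x).
Proof. by rewrite (d_invariant x y (- x)) subrr. Qed.

Lemma distN x : d 0 (- x) = d 0 x.
Proof. by rewrite dist_sym distE opprK add0r. Qed.

Lemma distD x y : d 0 (x + y) <= d 0 x + d 0 y.
Proof.
apply: le_trans (dist_triangle d x _ _) _.
by rewrite [d x _]distE addrAC subrr add0r.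
Qed.

Context (d_topology : induces_topology d).

Lemma dist_small_of_coord (e : R) : 0 < e -> exists2 r : R, 0 < r &
  forall x : V, (forall i, `|x 0 i| < r) -> d 0 x < e.
Proof.
move=> e0; have oB : open ([set x | d 0 x < e]%classic : set V).
  apply/d_topology; rewrite openE => y /= ye; apply/nbhs_ballP.
  exists (e - d 0 y) => /=; first by rewrite subr_gt0.
  move=> z; rewrite ballEmdist /= metric_spaceE ltrBrDl => yz.
  exact: le_lt_trans (dist_triangle d y _ _) yz.
have /nbhs_ballP[r /= r0 rB] : nbhs (0 : V) [set x | d 0 x < e]%classic.
  by apply: open_nbhs_nbhs; split => //=; rewrite dist_xx.
exists r => // x xr; apply: rB; split=> // i j.
by rewrite (ord1 i) mxE -ball_normE /= sub0r normrN.
Qed.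

Lemma coord_small_of_dist (e : R) : 0 < e -> exists2 r : R, 0 < r &
  forall x : V, d 0 x < r -> forall i, `|x 0 i| < e.
Proof.
move=> e0; have oB : open ((ball (0 : V) e)°)%classic by exact: open_interior.
have B0 : ((ball (0 : V) e)°)%classic 0.
  by rewrite /interior; exact: nbhsx_ballx.
move/d_topology : oB => oB.
have /nbhs_ballP[r /= r0 rB] := @open_nbhs_nbhs (metric_space d) _ _ (conj oB B0).
exists r => // x xr i.
have /interior_subset [_ /(_ 0 i)] : ((ball (0 : V) e)°)%classic x.
  by apply: rB; rewrite ballEmdist.
by rewrite mxE -ball_normE /= sub0r normrN.
Qed.

Lemma coord_bounded (rho : R) : proper_metric (metric_space d) ->
  exists M : R, forall x : V, d 0 x <= rho -> forall i, `|x 0 i| <= M.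
Proof.
move=> d_proper.
pose f : metric_space d -> V := id.
have fc : continuous f by apply/continuousP => A /d_topology.
have := continuous_compact (continuous_subspaceT fc) (d_proper 0 rho).
move/compact_bounded => [M [_ /(_ (M + 1))]] MB.
exists (M + 2) => x xrho i; have /= xM := MB _ x.
have : `|x| <= M + 1 by apply: xM; rewrite ?ltrDl //; exists x.
move=> xM1; have : ball (0 : V) (M + 2) x.
  by rewrite -ball_normE /= sub0r normrN (le_lt_trans xM1) // ltrD2l ltr1n.
by move=> [_ /(_ 0 i)]; rewrite mxE -ball_normE /= sub0r normrN => /ltW.
Qed.

(** The points of S reached by chains with steps less than e form a subset that
    is open and closed in S. *)
Lemma chain_in_connected (S : set (metric_space d)) (e : R) x : 0 < e ->
  connected S -> S 0 -> S x -> exists K (a : nat -> V), [/\ a 0%N = 0,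
    forall t, (K <= t)%N -> a t = x, forall t, S (a t)
    & forall t, d 0 (a t.+1 - a t) < e].
Proof.
move=> e0 Sc S0 Sx.
pose reach (y : V) := exists K (a : nat -> V), [/\ a 0%N = 0,
  forall t, (K <= t)%N -> a t = y, forall t, S (a t)
  & forall t, d 0 (a t.+1 - a t) < e].
have reach0 : reach 0.
  by exists 0%N, (fun=> 0); split=> // t; rewrite subrr dist_xx.
have reach_step y z : reach y -> S z -> d y z < e -> reach z.
  move=> [K [a [a0 aK aS ad]]] Sz yz.
  exists K.+1, (fun t => if (t <= K)%N then a t else z); split=> //.
  - by move=> t; rewrite ltnNge => /negPf ->.
  - by move=> t; case: ifP.
  - move=> t; have [tK|Kt] := leqP t K.
      have [tK'|] := leqP t.+1 K; first exact: ad.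
      by rewrite ltnS => Kt; rewrite (aK t Kt) -distE.
    by rewrite ltnNge ltnW // subrr dist_xx.
pose near_of (P : V -> Prop) : set (metric_space d) :=
  [set z | exists y, P y /\ d y z < e]%classic.
have near_open P : open (near_of P).
  rewrite openE => z [y [Py yz]]; apply/nbhs_ballP.
  exists (e - d y z) => /=; first by rewrite subr_gt0.
  move=> w; rewrite ballEmdist /= metric_spaceE ltrBrDl => zw.
  by exists y; split=> //; apply: le_lt_trans (dist_triangle d z _ _) zw.
suff RS : [set y | S y /\ reach y]%classic = S.
  by have [] : [set y | S y /\ reach y]%classic x by rewrite RS.
apply: Sc; first by exists 0.
  exists (near_of (fun y => S y /\ reach y)) => //.
  apply/seteqP; split=> [y [Sy ry]|y [Sy [z [[Sz rz] zy]]]].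
    by split=> //; exists y; rewrite dist_xx.
  by split=> //; exact: reach_step zy.
exists (~` near_of (fun y => S y /\ ~ reach y))%classic; first exact: open_closedC.
apply/seteqP; split=> [y [Sy ry]|y [Sy ny]].
  split=> // -[z [[Sz nrz] zy]]; apply: nrz; apply: reach_step ry Sz _.
  by rewrite dist_sym.
split=> //; apply: contrapT => nry; apply: ny; exists y; split=> //.
by rewrite dist_xx.
Qed.

End InvariantDistance.

(** * Coordinates adapted to a ball *)

Section Basis.
Context {R : realType} {n : nat}.
Local Notation V := 'rV[R]_n.

Lemma mulmx_small (X : 'M[R]_n) (e : R) : 0 < e -> exists2 r : R, 0 < r &
  forall t : V, (forall i, `|t 0 i| < r) -> forall i, `|(t *m X) 0 i| < e.
Proof.
move=> e0; pose B := 1 + \sum_i \sum_j `|X j i|.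
have Bi i : \sum_j `|X j i| < B.
  rewrite /B [X in _ < 1 + X](bigD1 i) //= addrCA ltrDl.
  rewrite ltr_pwDl // sumr_ge0 // => j _.
  by rewrite sumr_ge0.
have B0 : 0 < B by rewrite ltr_pwDl // !sumr_ge0 // => i _; rewrite sumr_ge0.
exists (e / B) => [|t tr i]; first by rewrite divr_gt0.
rewrite mxE; apply: le_lt_trans (ler_norm_sum _ _ _) _.
apply: (@le_lt_trans _ _ (\sum_j e / B * `|X j i|)).
  by apply: ler_sum => j _; rewrite normrM ler_wpM2r // ltW.
by rewrite -mulr_sumr mulrAC ltr_pdivrMr // ltr_pM2l.
Qed.

(** Cramer's rule for rows. *)
Lemma det_replace_row (X : 'M[R]_n) (x : V) i :
  \det (\matrix_(k, j) if k == i then x 0 j else X k j) = (x *m \adj X) 0 i.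
Proof.
set Y := \matrix_(_, _) _.
rewrite (expand_det_row Y i) !mxE; apply: eq_bigr => j _.
rewrite mxE eqxx [(\adj X) j i]mxE; congr (_ * _).
rewrite /cofactor; congr (_ * \det _); apply/matrixP => k l.
by rewrite !mxE eq_sym (negPf (neq_lift _ _)).
Qed.

(** Choose points of U whose determinant is at least half of the supremum. By
    Cramer's rule, a coordinate of a point x of U is the quotient of the
    determinant with one basis vector replaced by x by that of the basis. *)
Lemma extremal_basis (U : V -> Prop) (M e : R) :
  (forall x : V, U x -> forall i, `|x 0 i| <= M) ->
  0 < e -> (forall i, U (e *: delta_mx 0 i)) ->
  exists X : 'M[R]_n, [/\ X \in unitmx, forall i, U (row i X)
    & forall x, U x -> forall i, `|(x *m invmx X) 0 i| <= 2].
Proof.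
move=> UM e0 Ue.
pose D : set R := [set `|\det X| | X in
   fun X : 'M[R]_n => forall i, U (row i X)]%classic.
have Dscal : D (e ^+ n).
  exists (e%:M); last by rewrite det_scalar ger0_norm // exprn_ge0 // ltW.
  by move=> i /=; rewrite rowE mul_mx_scalar.
have Dub : has_ubound D.
  exists (\sum_(s : 'S_n) \prod_(i < n) M) => _ [X XU <-].
  apply: le_trans (ler_norm_sum _ _ _) _; apply: ler_sum => s _.
  rewrite normrM normrX normrN1 expr1n mul1r normr_prod; apply: ler_prod => i _.
  by rewrite normr_ge0; have := UM _ (XU i) (s i); rewrite mxE.
have Dsup : has_sup D by split=> //; exists (e ^+ n).
have supD0 : 0 < sup D.
  by apply: lt_le_trans (ub_le_sup Dub Dscal); rewrite exprn_gt0.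
have /sup_adherent/(_ Dsup) [_ [X XU <-]] : 0 < sup D / 2 by rewrite divr_gt0.
rewrite {1}[sup D]splitr addrK => detX.
have detX0 : 0 < `|\det X| by apply: lt_trans detX; rewrite divr_gt0.
have Xunit : X \in unitmx by rewrite unitmxE unitfE -normr_gt0.
exists X; split=> // x Ux i.
have : `|(x *m \adj X) 0 i| <= sup D.
  rewrite -det_replace_row; apply: (ub_le_sup Dub).
  set Y := \matrix_(_, _) _; exists Y => // k.
  have -> : row k Y = if k == i then x else row k X.
    by apply/rowP => j; rewrite !mxE; case: ifP; rewrite ?mxE.
  by case: ifP.
have -> : \adj X = \det X *: invmx X.
  by rewrite /invmx Xunit scalerA divff ?scale1r // -normr_gt0.
rewrite -scalemxAr mxE normrM => le_sup.
rewrite -(ler_pM2l detX0); apply: le_trans le_sup _.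
by rewrite -ler_pdivrMr // ltW.
Qed.

End Basis.

Section Scale.
Context {R : realType} {n : nat} (d : distance R 'rV[R]_n).
Context (d_proper : proper_metric (metric_space d)).
Context (d_invariant : translation_invariant d).
Context (d_topology : induces_topology d).
Context (d_connected : linearly_connected (metric_space d)).
Local Notation V := 'rV[R]_n.

Lemma diam_leP (A : set (metric_space d)) (s : R) :
  (diam A <= s%:E)%E <-> forall x y : V, A x -> A y -> d x y <= s.
Proof.
split=> [As x y Ax Ay|As].
  rewrite -lee_fin; apply: le_trans As; apply: ereal_sup_ubound.
  by exists (x, y).
by apply: ge_ereal_sup => _ [[x y] [Ax Ay] <-]; rewrite lee_fin; exact: As.
Qed.

(** U is the connected component of 0 in the ball of radius lam * s. Choosing
    the basis extremal in U, and not in the ball of radius s, keeps the sets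
    joining 0 to the basis vectors inside the cube of radius 2. *)
Lemma ball_parallelepiped : exists2 C : R, 0 < C & forall s : R, 0 < s ->
  exists X : 'M[R]_n, [/\ X \in unitmx,
    forall x : V, d 0 x <= s -> forall i, `|(x *m invmx X) 0 i| <= 2
  & forall t : V, (forall i, `|t 0 i| <= 1) -> d 0 (t *m X) <= C * s].
Proof.
have [lam lam1 lamP] := d_connected.
have lam0 : 0 < lam by apply: lt_le_trans lam1.
exists (((4 * n + 4).+1 ^ n * (2 * n + 3))%:R * lam).
  by rewrite mulr_gt0 // ltr0n muln_gt0 expn_gt0 addn_gt0 orbT.
move=> s s0; have rho0 : 0 < lam * s by rewrite mulr_gt0.
pose U (x : V) := exists S : set (metric_space d),
  [/\ connected S, S 0, S x & forall y : V, S y -> d 0 y <= lam * s].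
have ballU x : d 0 x <= s -> U x.
  move=> xs; have [S [Sc S0 Sx Sd]] := lamP 0 x; exists S; split=> // y Sy.
  move/diam_leP : Sd => /(_ _ _ S0 Sy) /le_trans; apply.
  by rewrite ler_pM2l.
have UN x : U x -> d 0 x <= lam * s by move=> [S [_ _ Sx]]; apply.
have [M MP] := coord_bounded d_topology (lam * s) d_proper.
have [r r0 rP] := dist_small_of_coord d_topology s0.
have e0 : 0 < r / 2 by rewrite divr_gt0.
have Ue i : U (r / 2 *: delta_mx 0 i).
  apply/ballU/ltW/rP => j; rewrite !mxE eqxx /=.
  case: (j == i); rewrite ?mulr0 ?normr0 // mulr1 ger0_norm ?ltW //.
  by rewrite ltr_pdivrMr // ltr_pMr // ltr1n.
have [X [Xunit UX X2]] := extremal_basis (fun x Ux => MP x (UN x Ux)) e0 Ue.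
exists X; split=> // [x xs|t t1]; first exact/X2/ballU.
pose N (t : V) := d 0 (t *m X); pose U' (t : V) := U (t *m X).
have gN : group_norm N.
  split=> [|x|x y|e e1]; rewrite /N.
  - by rewrite mul0mx dist_xx.
  - by rewrite mulNmx distN.
  - by rewrite mulmxDl distD.
  - have [r1 r10 r1P] := dist_small_of_coord d_topology e1.
    have [r2 r20 r2P] := mulmx_small X r10.
    by exists r2 => // x xr2; apply/r1P/r2P.
have U'chain : chained U'.
  move=> e x e1 [S [Sc S0 Sx Sd]].
  have [r1 r10 r1P] := mulmx_small (invmx X) e1.
  have [r2 r20 r2P] := coord_small_of_dist d_topology r10.
  have [K [a [a0 aK aS ad]]] := chain_in_connected d_invariant r20 Sc S0 Sx.
  exists K, (fun t => a t *m invmx X); split=> [|k kK|k|k i].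
  - by rewrite a0 mul0mx.
  - by rewrite aK // mulmxK.
  - by exists S; split=> //; rewrite mulmxKV.
  - by rewrite -mulmxBl; apply/r1P/r2P.
rewrite -mulrA.
apply: (@unit_cube_bounded R n N gN (lam * s) U' rho0 (fun x => UN _)) => //.
  by move=> x i /X2 /(_ i); rewrite mulmxK.
by move=> i; rewrite /U' -rowE; exact: UX.
Qed.

End Scale.

(** * Upper bound: boxes in n + 1 colours *)

(** Boxes of the same colour are separated by a gap, the multiples of e. *)
Lemma divz_gap (a b : int) (e : nat) : (0 < e)%N ->
  ((b %% e)%Z != 0) -> ((a %/ e)%Z < (b %/ e)%Z) -> a + 2 <= b.
Proof.
move=> e0 be ab; rewrite (divz_eq a e) (divz_eq b e).
have e0' : (0 < e :> int) by [].
have := ltz_pmod a e0'; have := modz_ge0 b (lt0r_neq0 e0').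
move: be ab; move: (a %/ e)%Z (b %/ e)%Z (a %% e)%Z (b %% e)%Z => q q' r r'.
nia.
Qed.

Lemma divz_close (a b : int) (e : nat) : (0 < e)%N ->
  (a %/ e)%Z = (b %/ e)%Z -> b <= a + e.
Proof.
move=> e0 ab; rewrite (divz_eq a e) (divz_eq b e) ab.
have e0' : (0 < e :> int) by [].
have := ltz_pmod b e0'; have := modz_ge0 a (lt0r_neq0 e0').
lia.
Qed.

(** The infimum defining the multiplicity is attained when it is finite. *)
Lemma multiplicity_leP (R : realType) (X : metricType R) (s : R)
    (B : set (set X)) (m : nat) :
  (multiplicity s B <= m%:R%:E)%E <->
  forall A : set X, (diam A <= s%:E)%E ->
    ([set b | B b /\ (b `&` A !=set0)%classic]%classic #<= `I_m)%card.
Proof.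
split=> [Bm A As|Bm]; last first.
  by apply: ereal_inf_lbound; exists m.
have : (multiplicity s B < m.+1%:R%:E)%E.
  by apply: le_lt_trans Bm _; rewrite lte_fin ltr_nat.
move=> /ereal_inf_lt[_ [k kP <-]]; rewrite lte_fin ltr_nat ltnS => km.
by apply: card_le_trans (kP A As) _; rewrite card_le_II.
Qed.

Section BoxCover.
Context {R : realType} {n : nat} (d : distance R 'rV[R]_n).
Context (d_proper : proper_metric (metric_space d)).
Context (d_invariant : translation_invariant d).
Context (d_topology : induces_topology d).
Context (d_connected : linearly_connected (metric_space d)).
Local Notation V := 'rV[R]_n.

Lemma dist_scale (X : 'M[R]_n) (D : R) :
  (forall t : V, (forall i, `|t 0 i| <= 1) -> d 0 (t *m X) <= D) ->
  forall (K : nat) (t : V), (forall i, `|t 0 i| <= K%:R) ->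
  d 0 (t *m X) <= K%:R * D.
Proof.
move=> D1; elim=> [t t0|K IH t tK].
  suff -> : t = 0 by rewrite mul0mx dist_xx mul0r.
  by apply/rowP => i; rewrite mxE; apply/normr0_eq0/le_anti; rewrite t0 normr_ge0.
have K0 : 0 < K.+1%:R :> R by rewrite ltr0n.
have tE : t = (K%:R / K.+1%:R) *: t + K.+1%:R^-1 *: t.
  rewrite -scalerDl -[X in _ + X]mul1r -mulrDl natr1 divff ?scale1r //.
have -> : K.+1%:R * D = K%:R * D + D by rewrite -natr1 mulrDl mul1r.
rewrite tE mulmxDl; apply: le_trans (distD d_invariant _ _) _.
apply: lerD; [apply: IH|apply: D1] => i;
  rewrite mxE normrM ger0_norm ?divr_ge0 ?invr_ge0 //.
  by rewrite mulrAC ler_pdivrMr //; apply: ler_wpM2l; rewrite ?tK.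
by rewrite ler_pdivrMl // mulr1 tK.
Qed.

(** Cut the coordinate axes into intervals of length 2, numbered by integers k. In
    colour j, discard those with k = j modulo n + 1; the others are grouped in
    runs of n intervals, and z selects a run on every axis. Two different boxes
    of the same colour differ by more than 2 in some coordinate. *)
Definition box (X : 'M[R]_n) (j : nat) (z : 'I_n -> int) : set V :=
  [set x | forall i, let k := Num.floor ((x *m invmx X) 0 i / 2) - j%:Z in
     (k %/ n.+1)%Z = z i /\ (k %% n.+1)%Z != 0]%classic.

(** Each of the n coordinates of a point excludes one colour, so one of the n + 1
    colours remains. A set of diameter at most s has coordinates within 2 of
    each other, and so meets at most one box of each colour. *)
Lemma coloured_box_cover : exists2 c : R, 0 < c & forall s : R, 0 < s ->
  exists B : set (set (metric_space d)), [/\ is_cover B, bounded_cover (c * s) B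
    & (multiplicity s B <= n.+1%:R%:E)%E].
Proof.
have [C C0 CP] :=
  ball_parallelepiped d_proper d_invariant d_topology d_connected.
(* A run of intervals has length less than 2 (n + 2) on each axis. *)
exists (((2 * n.+2)%:R) * C); first by rewrite mulr_gt0 // ltr0n.
move=> s s0; have [X [Xunit ballX cubeX]] := CP s s0.
pose y (x : V) i := (x *m invmx X) 0 i.
have yB (x x' : V) i : ((x' - x) *m invmx X) 0 i = y x' i - y x i.
  by rewrite mulmxBl mxE [X in _ + X]mxE.
have fl (a : R) : (Num.floor a)%:~R <= a < (Num.floor a)%:~R + 1.
  by rewrite ge_floor -[1]/(1%:~R) -intrD floorD1_gt.
exists [set b | exists j z, (j < n.+1)%N /\ b = box X j z]%classic; split.
- rewrite /is_cover -subTset => x _.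
  have [j jP] : exists j : 'I_n.+1,
      forall i, ((Num.floor (y x i / 2) - j%:Z) %% n.+1)%Z != 0.
    pose r i : 'I_n.+1 := inord `|(Num.floor (y x i / 2) %% n.+1)%Z|%N.
    have [j jr] : exists j, j \notin codom r.
      apply/existsP; rewrite -negb_forall; apply/negP => /forallP all_r.
      have /eq_card cr : codom r =i predT by move=> l; rewrite all_r.
      by have := leq_image_card r predT; rewrite -/(codom r) cr !card_ord ltnn.
    exists j => i; apply: contra jr => /eqP jmod; apply/codomP; exists i.
    apply/val_inj; rewrite /r /= inordK.
      have : (Num.floor (y x i / 2) == j%:Z %[mod n.+1])%Z.
        by rewrite eqz_mod_dvd; apply/dvdz_mod0P.
      by move=> /eqP ->; rewrite modz_nat modn_small.
    have := ltz_pmod (Num.floor (y x i / 2)) (isT : 0 < n.+1 :> int).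
    have := modz_ge0 (Num.floor (y x i / 2)) (isT : n.+1 != 0 :> int).
    lia.
  exists (box X j (fun i => ((Num.floor (y x i / 2) - j%:Z) %/ n.+1)%Z)).
    by exists j, (fun i => ((Num.floor (y x i / 2) - j%:Z) %/ n.+1)%Z).
  by move=> i; split=> //; exact: jP.
- move=> _ [j [z [jn ->]]]; apply/diam_leP => x x' bx bx'.
  rewrite distE // -(mulmxKV Xunit (x' - x)) -mulrA.
  apply: dist_scale => [|i]; first exact: cubeX.
  have [e _] := bx i; have [e' _] := bx' i.
  have := divz_close (isT : 0 < n.+1)%N (etrans e (esym e')).
  have := divz_close (isT : 0 < n.+1)%N (etrans e' (esym e)).
  rewrite yB -/(y x i) -/(y x' i) -!(ler_int R) !intrD !mulrNz -!pmulrn.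
  have := fl (y x i / 2); have := fl (y x' i / 2).
  move: (_%:~R) (_%:~R) => u v.
  rewrite ler_norml natrM -[n.+2]addn2 natrD -[n.+1%:R]natr1.
  move=> /andP[? ?] /andP[? ?] ? ?; apply/andP; split; lra.
- apply: (multiplicity_leP _ _ _).2 => A As.
  have /choice[h hP] : forall j : nat, exists b : set V, forall z,
      (box X j z `&` A !=set0)%classic -> box X j z = b.
    move=> j; have [[z zA]|noz] :=
      pselect (exists z, (box X j z `&` A !=set0)%classic).
      exists (box X j z) => z' [x' [bx' Ax']]; case: zA => x [bx Ax].
      suff -> : z' = z by [].
      apply/funext => i.
      have close (u v : V) : A u -> A v -> y v i - y u i <= 2.
        move=> Au Av; move/diam_leP : As => /(_ _ _ Au Av).
        rewrite distE // => /ballX /(_ i); rewrite yB; apply: le_trans.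
        exact: ler_norm.
      have far (u v : V) w w' : box X j w u -> box X j w' v -> A u -> A v ->
          ~ (w i < w' i).
        move=> /(_ i)[eu _] /(_ i)[ev nv] Au Av; rewrite -eu -ev.
        move=> /(divz_gap (isT : 0 < n.+1)%N nv); have := close _ _ Au Av.
        rewrite -/(y u i) -/(y v i) -!(ler_int R) !intrD.
        have := fl (y u i / 2); have := fl (y v i / 2).
        move: (_%:~R) (_%:~R) => p q /andP[? ?] /andP[? ?]; lra.
      apply/le_anti/andP; split; rewrite leNgt; apply/negP.
        exact: far bx bx' Ax Ax'.
      exact: far bx' bx Ax' Ax.
    by exists set0 => z zA; case: noz; exists z.
  apply: card_le_trans (card_image_le h `I_n.+1)%classic.
  apply: subset_card_le => _ [[j [z [jn ->]]] bA]; exists j => //.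
  by rewrite -(hP _ _ bA).
Qed.

End BoxCover.

(** * Lower bound: fine covers of the unit cube *)

Lemma card_le_inj_ord (T : Type) (A : set T) n k (f : 'I_n -> T) :
  injective f -> (forall i, A (f i)) -> (A #<= `I_k)%card -> (n <= k)%N.
Proof.
move=> f_inj Af Ak; rewrite -card_le_II; apply: card_le_trans Ak.
have fA : ([set f i | i in [set: 'I_n]] `<=` A)%classic by move=> _ [i _ <-].
apply: card_le_trans (subset_card_le fA).
have /card_eqPle[_ le1] : ([set f i | i in [set: 'I_n]] #= [set: 'I_n])%card.
  by apply: inj_card_eq => i j _ _; exact: f_inj.
have /card_eqPle[le2 _] := @card_II n.
exact: card_le_trans le2 le1.
Qed.

Section Lower.
Context {R : realType} {n : nat} (d : distance R 'rV[R]_n).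
Context (d_invariant : translation_invariant d).
Context (d_topology : induces_topology d).
Local Notation V := 'rV[R]_n.

(** The label of a vertex depends only on the cover member chosen for it, so
    vertices with different labels lie in different members. *)
Lemma small_cover_multiplicity : exists2 D : R, 0 < D &
  forall (B : set (set (metric_space d))) (s : R) (k : nat),
    is_cover B -> bounded_cover D B -> 0 < s ->
    (multiplicity s B <= k%:R%:E)%E -> (n.+1 <= k)%N.
Proof.
have [D D0 DP] := coord_small_of_dist d_topology ltr01.
exists (D / 2); first by rewrite divr_gt0.
move=> B s k Bcov Bbd s0 /multiplicity_leP Bk.
have [r r0 rP] := dist_small_of_coord d_topology s0.
pose m := Num.truncn r^-1.
have mr : m.+1%:R^-1 < r by rewrite invf_plt ?posrE ?ltr0n // truncnS_gt.
have m0 : 0 < m.+1%:R :> R by rewrite ltr0n.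
pose p (v : {ffun 'I_n -> 'I_m.+2}) : V := \row_i ((v i)%:R / m.+1%:R).
have /choice[b bP] : forall v, exists b : set V, B b /\ b (p v).
  move=> v; have : (\bigcup_(b in B) b)%classic (p v) by rewrite Bcov.
  by move=> [b Bb bv]; exists b.
pose P v i := `[< exists2 y, b v y & y 0 i = 0 >].
have Pmin (v : {ffun _}) i : v i = 0 -> P v i.
  move=> vi; apply/asboolP; exists (p v); first by have [] := bP v.
  by rewrite mxE vi mul0r.
have Pmax (v : {ffun _}) i : v i = ord_max -> ~~ P v i.
  move=> vi; apply/asboolPn => -[y by_ yi].
  have [Bb bv] := bP v; move/diam_leP : (Bbd _ Bb) => /(_ _ _ by_ bv).
  rewrite distE // => dyv.
  have := DP _ (le_lt_trans dyv _) i; rewrite !mxE yi vi subr0 divff ?gt_eqF //.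
  rewrite normr1 ltxx ltr_pdivrMr // ltr_pMr // ltr1n.
  by move=> /(_ isT).
have [x [xmax xP]] := sperner_cube Pmin Pmax.
have [C CP] := choice xP.
pose A : set (metric_space d) :=
  [set y | exists E, y = p (x + corner E)]%classic.
have diamA : (diam A <= s%:E)%E.
  apply/diam_leP => _ _ [E ->] [F ->]; rewrite distE //; apply/ltW/rP => i.
  apply: le_lt_trans mr; rewrite !mxE -mulrBl normrM.
  rewrite [X in _ * X]gtr0_norm ?invr_gt0 //.
  rewrite ler_piMl ?invr_ge0 ?ler0n //.
  have corner_val G : (x + corner G) i = (x i + (i \in G))%N :> nat.
    rewrite !ffunE; have := xmax i; rewrite -val_eqE /= => xi.
    have xlt := ltn_ord (x i).
    by case: (i \in G); rewrite /= ?modn_small //=; lia.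
  rewrite !corner_val !natrD opprD addrACA subrr add0r.
  by case: (i \in E); case: (i \in F);
    rewrite ?subrr ?subr0 ?sub0r ?normrN ?normr0 ?normr1.
apply: (card_le_inj_ord (f := fun l => b (x + corner (C l)))) (Bk A diamA).
  by move=> l l' bl; rewrite -(CP l) -(CP l') /P bl.
move=> l; have [Bb bv] := bP (x + corner (C l)); split=> //.
by exists (p (x + corner (C l))); split=> //; exists (C l).
Qed.

End Lower.

Unset Implicit Arguments.

Theorem theorem1p5 (R : realType) (n : nat) (d : distance R 'rV[R]_n)
  (d_proper : proper_metric (metric_space d))
  (d_invariant : translation_invariant d)
  (d_topology : induces_topology d)
  (d_connected : linearly_connected (metric_space d)) :
  nagata_dim (metric_space d) = n%:R%:E.
Proof.
apply/le_anti/andP; split.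
  apply: ereal_inf_lbound; exists n => //.
  exact: coloured_box_cover d_proper d_invariant d_topology d_connected.
apply: le_ereal_inf_tmp => _ [k [c c0 cP] <-]; rewrite lee_fin ler_nat.
have [D D0 DP] := small_cover_multiplicity d_invariant d_topology.
have s0 : 0 < D / c by rewrite divr_gt0.
have [B [Bcov Bbd Bmul]] := cP _ s0.
rewrite -ltnS; apply: DP Bcov _ s0 Bmul.
by move: Bbd; rewrite mulrC divfK // gt_eqF.
Qed.
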